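(* Let $G$ be an abelian group generated by a finite set $X$. Then there exist only finitely many dead ends in $G$ with respect to $X$.
   Context: For a group $G$ with finite generating set $X$, the Cayley graph $\Gamma(G,X)$ is the graph with vertex set $G$ whose edges are the pairs $(g_1,g_2)\in G\times G$ with $g_1^{-1}g_2\in X^{\pm1}=X\cup X^{-1}$. Giving every edge length $1$ yields the metric $d=d_X$ (on $G$ this is the word metric). For $g\in G$ and $r\ge 0$, $B_g(r)$ denotes the ball of radius $r$ with center $g$, i.e. $B_g(r)=\{h\in G : d(g,h)\le r\}$. An element $g\in G$ with $n=d(1,g)$ is called a dead end of $G$ with respect to $X$ if $B_g(1)\subseteq B_1(n)$, i.e. every neighbour of $g$ in the Cayley graph has distance at most $n$ from $1$. *)

(* Defs.v *)
From HB Require Import structures.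
From mathcomp Require Import all_boot.
From mathcomp Require Import boolp classical_sets functions cardinality.

Set Implicit Arguments.
Unset Strict Implicit.
Unset Printing Implicit Defensive.

Local Open Scope classical_set_scope.
Local Open Scope group_scope.

Definition abelian_group (G : groupType) : Prop := forall x y : G, commute x y.

Definition subgroup_generated (G : groupType) (X : set G) : set G :=
  smallest [set H : set G | group_closed (mem H)] X.

Definition generates (G : groupType) (X : set G) : Prop :=
  subgroup_generated X = [set: G].

Definition cayley_edge (G : groupType) (X : set G) : rel G :=
  fun g h => g^-1 * h \in X `|` [set x^-1 | x in X].

Definition cayley_walk (G : groupType) (X : set G) (n : nat) (g h : G) : Prop :=
  exists s : seq G, [/\ path (cayley_edge X) g s, last g s = h & size s = n].

(* The junk value 0 for vertices that no walk joins is never taken when X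
   generates G. *)
Definition cayley_dist (G : groupType) (X : set G) (g h : G) : nat :=
  xget 0%N [set n | cayley_walk X n g h /\
                    forall m, cayley_walk X m g h -> (n <= m)%N].

(* Distances are integers, so a natural radius loses no generality. *)
Definition cayley_ball (G : groupType) (X : set G) (g : G) (r : nat) : set G :=
  [set h | (cayley_dist X g h <= r)%N].

Definition dead_end (G : groupType) (X : set G) (g : G) : Prop :=
  cayley_ball X g 1 `<=` cayley_ball X 1 (cayley_dist X 1 g).

(* Main.v *)
Require Import Defs.
From HB Require Import structures.
From mathcomp Require Import all_boot.
From mathcomp Require Import boolp classical_sets functions cardinality.

(** Every dead end [g] is spelled by a geodesic word, and since [G] is abelian a
    word matters only through the number of times it uses each of the finitely
    many letters in [letters X], the generators and their inverses; so dead
    ends become vectors of natural numbers of a fixed length.  Distinct dead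
    ends give incomparable vectors ([dead_end_antichain]).  Indeed, suppose that
    the vector of [g] lies strictly below that of [h].  The geodesic of [h] can
    then be reordered as the geodesic [u] of [g] followed by a nonempty word
    [x :: r].  Since [g] is a dead end, [g * x] is also spelled by a word no
    longer than [u]; followed by [r], this word spells [h] with fewer letters
    than its geodesic has, which is absurd ([geodesic_dead_end_maximal]).  By
    Dickson's lemma ([dickson]) an infinite family of vectors in N^k has two
    comparable members, so there are only finitely many dead ends. *)

Local Open Scope classical_set_scope.

Set Implicit Arguments.
Unset Strict Implicit.
Unset Printing Implicit Defensive.

(** Jump repeatedly to an index where [f] is minimal among all the later ones:
    the value at such an index bounds all subsequent values from below. *)
Lemma nondecreasing_subsequence (f : nat -> nat) :
  exists2 phi : nat -> nat, {homo phi : m n / m < n} &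
    {homo f \o phi : m n / m <= n}.
Proof.
have argmin n : exists m, n <= m /\ forall k, n <= k -> f m <= f k.
  have exP : exists v, `[< exists2 m, n <= m & f m = v >].
    by exists (f n); apply/asboolP; exists n.
  case: (ex_minnP exP) => v /asboolP[m nm fm] vmin.
  exists m; split=> // k nk; rewrite fm; apply: vmin.
  by apply/asboolP; exists k.
have [a aP] := choice argmin.
have a_ge n : n <= a n by case: (aP n).
have a_min n k : n <= k -> f (a n) <= f k by case: (aP n) => _; apply.
pose phi := fix phi n := if n is n'.+1 then a (phi n').+1 else a 0.
have phiS n : phi n < phi n.+1 by apply: a_ge.
exists phi; first exact: homo_ltn ltn_trans phiS.
apply: homo_leq => //; first exact: leq_trans.
(* [phi n] is [a k] for some [k <= phi n.+1], and [f (a k)] is minimal from [k] on. *)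
by case=> [|n]; apply: a_min => //; apply: ltn_trans (phiS n) (phiS n.+1).
Qed.

(** Passing to a further subsequence keeps the coordinates already treated
    nondecreasing, so the coordinates can be handled one at a time. *)
Lemma nondecreasing_subsequence_coords (I : eqType) (s : seq I)
    (F : nat -> I -> nat) :
  exists2 phi : nat -> nat, {homo phi : m n / m < n} &
    forall i, i \in s -> {homo (F \o phi)^~ i : m n / m <= n}.
Proof.
elim: s => [|i s [phi phi_lt Fphi]]; first by exists id.
have [psi psi_lt Fpsi] := nondecreasing_subsequence ((F \o phi)^~ i).
have psi_le : {homo psi : m n / m <= n} by apply: ltnW_homo.
exists (phi \o psi) => [m n mn|j]; first exact/phi_lt/psi_lt.
rewrite inE => /predU1P[-> // | js] m n mn.
exact/(Fphi _ js)/psi_le.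
Qed.

Lemma infinite_set_inj_seq (T : Type) (A : set T) : infinite_set A ->
  exists2 g : nat -> T, injective g & forall n, A (g n).
Proof.
elim/Ppointed: T => T in A *.
  by move=> Ainf; exfalso; apply: Ainf; rewrite emptyE.
move=> /infiniteP/pcard_leP[g]; exists g => [m n|n]; last exact: funS.
by apply: inj; rewrite inE.
Qed.

(** Dickson's lemma: enumerate infinitely many points of [A] and extract a
    subsequence nondecreasing in every coordinate; its first two terms do. *)
Lemma dickson (T : Type) (I : eqType) (s : seq I) (F : T -> I -> nat)
    (A : set T) : infinite_set A ->
  exists x y, [/\ A x, A y, x <> y & forall i, i \in s -> F x i <= F y i].
Proof.
move=> /infinite_set_inj_seq[g g_inj Ag].
have [phi phi_lt Fphi] := nondecreasing_subsequence_coords s (F \o g).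
exists (g (phi 0)), (g (phi 1)); split=> //; last by move=> i /Fphi; apply.
by move/g_inj => e; have := phi_lt 0 1 isT; rewrite e ltnn.
Qed.

Section Words.
Local Open Scope group_scope.
Variables (G : groupType) (X : set G).

Definition letters : set G := X `|` [set x^-1 | x in X].

Definition word_prod (w : seq G) : G := \prod_(x <- w) x.

Lemma word_prod_cat u v : word_prod (u ++ v) = word_prod u * word_prod v.
Proof. exact: big_cat. Qed.

Lemma word_prod_cons x w : word_prod (x :: w) = x * word_prod w.
Proof. exact: big_cons. Qed.

Lemma perm_word_prod (abG : abelian_group G) u v :
  perm_eq u v -> word_prod u = word_prod v.
Proof.
move=> uv.
pose mulC : Monoid.com_law (1 : G) := HB.pack (@mul G)
  (Monoid.isComLaw.Build G 1 (@mul G) (@mulgA G) abG (@mul1g G)).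
exact: (@perm_big _ mulC 1 _ _ _ _ _ uv).
Qed.

Lemma cayley_walkP n g h : cayley_walk X n g h <->
  exists w, [/\ {subset w <= letters}, g * word_prod w = h & size w = n].
Proof.
split=> [[s [+ + <-]] | [w [+ + <-]]] {n}.
  elim: s g => [|x s IHs] g /=; first by exists [::]; rewrite /word_prod big_nil mulg1.
  case/andP=> gx /IHs{}IHs /IHs[w [wX <- <-]].
  exists (g^-1 * x :: w); split=> //; last by rewrite word_prod_cons mulgA mulVKg.
  by move=> y; rewrite in_cons => /predU1P[-> // | /wX].
elim: w g => [|x w IHw] g wX.
  by rewrite /word_prod big_nil mulg1 => <-; exists [::].
have wX' : {subset w <= letters} by move=> y yw; apply: wX; rewrite mem_behead.
rewrite word_prod_cons mulgA => /(IHw _ wX')[s [sX s_last s_size]].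
exists (g * x :: s); split=> //=; last by rewrite s_size.
rewrite sX andbT /cayley_edge mulKg.
exact: (wX _ (mem_head _ _)).
Qed.

Lemma letters_inv x : x \in letters -> x^-1 \in letters.
Proof.
rewrite !inE => -[Xx|[y Xy <-]]; first by right; exists x.
by left; rewrite invgK.
Qed.

Hypothesis genX : generates X.

(** The values of words form a subgroup containing [X]: the inverse of a word is
    the reversed word of inverse letters. *)
Lemma generates_word g : exists2 w, {subset w <= letters} & word_prod w = g.
Proof.
pose H := [set h | exists2 w, {subset w <= letters} & word_prod w = h].
suff : subgroup_generated X `<=` H by rewrite genX; apply.
apply: smallest_sub => [/=|x Xx]; last first.
  exists [:: x]; last by rewrite /word_prod big_seq1.
  by move=> y; rewrite mem_seq1 => /eqP->; apply/mem_set; left.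
split=> [|a b]; first by rewrite inE; exists [::]; rewrite /word_prod ?big_nil.
rewrite !inE => -[u uX <-] [v vX <-].
exists (u ++ [seq x^-1 | x <- rev v]).
  move=> y; rewrite mem_cat => /orP[/uX //|/mapP[z + ->]].
  by rewrite mem_rev => /vX; apply: letters_inv.
by rewrite word_prod_cat /word_prod big_map prodgV revK.
Qed.

(** Since [X] generates [G], some walk joins [g] to [h], hence also a shortest
    one, and [cayley_dist] is its genuine length. *)
Lemma cayley_distP g h : cayley_walk X (cayley_dist X g h) g h /\
  forall m, cayley_walk X m g h -> (cayley_dist X g h <= m)%N.
Proof.
apply: (@xgetPex _ 0%N [set n | cayley_walk X n g h /\
  forall m, cayley_walk X m g h -> (n <= m)%N]).
have exn : exists n, `[< cayley_walk X n g h >].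
  have [w wX wE] := generates_word (g^-1 * h); exists (size w); apply/asboolP.
  by apply/cayley_walkP; exists w; rewrite wE mulVKg.
case: (ex_minnP exn) => n /asboolP n_walk n_min; exists n; split=> // m mP.
exact/n_min/asboolP.
Qed.

Lemma leq_cayley_dist g w : {subset w <= letters} ->
  (cayley_dist X g (g * word_prod w) <= size w)%N.
Proof. by move=> wX; apply: (cayley_distP _ _).2; apply/cayley_walkP; exists w. Qed.

Definition geodesic (w : seq G) : Prop :=
  {subset w <= letters} /\ size w = cayley_dist X 1 (word_prod w).

Lemma geodesic_exists g : exists2 w, geodesic w & word_prod w = g.
Proof.
have [/cayley_walkP[w [wX + wn]] _] := cayley_distP 1 g.
by rewrite mul1g => wg; exists w; rewrite /geodesic ?wg ?wn.
Qed.

Lemma geodesic_min w u : geodesic w -> {subset u <= letters} ->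
  word_prod u = word_prod w -> (size w <= size u)%N.
Proof. by move=> [_ ->] /(leq_cayley_dist 1) + <-; rewrite mul1g. Qed.

Lemma dead_end_mulg_letter g x : dead_end X g -> x \in letters ->
  (cayley_dist X 1 (g * x)%g <= cayley_dist X 1 g)%N.
Proof.
move=> g_dead xX; apply: g_dead.
have := @leq_cayley_dist g [:: x]; rewrite /word_prod big_seq1; apply.
by move=> y; rewrite mem_seq1 => /eqP->.
Qed.

(** If [r] started with a letter [x], then, [word_prod w] being a dead end, a
    word [u] no longer than [w] would spell [word_prod w * x]; replacing the
    prefix [rcons w x] by [u] would shorten the geodesic. *)
Lemma geodesic_dead_end_maximal w r : geodesic (w ++ r) -> geodesic w ->
  dead_end X (word_prod w) -> r = [::].
Proof.
case: r => // x r wr_geo [_ w_size] w_dead; exfalso.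
have [wrX _] := wr_geo.
have xX : x \in letters by apply: wrX; rewrite mem_cat mem_head orbT.
have [u [uX u_size] uE] := geodesic_exists (word_prod w * x).
have short : (size u <= size w)%N.
  by rewrite u_size uE w_size; apply: dead_end_mulg_letter.
have : (size (w ++ x :: r) <= size (u ++ r))%N.
  apply: geodesic_min => // [y|].
    rewrite mem_cat => /orP[/uX//|yr]; apply: wrX.
    by rewrite mem_cat in_cons yr !orbT.
  by rewrite !word_prod_cat uE word_prod_cons mulgA.
by rewrite !size_cat /= addnS leqNgt ltnS leq_add2r short.
Qed.

Hypothesis abG : abelian_group G.

Lemma perm_geodesic u v : perm_eq u v -> geodesic u -> geodesic v.
Proof.
move=> uv [uX u_size]; split=> [x|]; first by rewrite -(perm_mem uv); apply: uX.
by rewrite -(perm_size uv) -(perm_word_prod abG uv).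
Qed.

(** Comparable letter counts make [u], up to reordering, a prefix of [v];
    reordering does not affect geodesics in an abelian group, so a dead end
    at [u] leaves no room for further letters in [v]. *)
Lemma dead_end_antichain u v : geodesic u -> geodesic v ->
  dead_end X (word_prod u) ->
  {in letters, forall x, count_mem x u <= count_mem x v}%N ->
  word_prod u = word_prod v.
Proof.
move=> u_geo v_geo u_dead uv.
have /count_subseqP[t tv ut] : forall x, (count_mem x u <= count_mem x v)%N.
  move=> x; have [/(proj1 u_geo)/uv//|/count_memPn-> //] := boolP (x \in u).
have [r vr] := perm_to_subseq tv.
have vur : perm_eq v (u ++ r) by rewrite (perm_trans vr) // perm_cat2r perm_sym.
have := geodesic_dead_end_maximal (perm_geodesic vur v_geo) u_geo u_dead.
by move=> r0; rewrite (perm_word_prod abG vur) r0 cats0.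
Qed.
End Words.

Theorem theorem1 (G : groupType) (abG : abelian_group G)
    (X : set G) (finX : finite_set X) (genX : generates X) :
  finite_set [set g : G | dead_end X g].
Proof.
have /finite_seqP[s sE] : finite_set (letters X).
  by rewrite finite_setU; split=> //; apply: finite_image.
have [g|W W_geo] := @choice G (seq G) (fun g w => geodesic X w /\ word_prod w = g).
  by have [w] := geodesic_exists genX g; exists w.
apply: contrapT => /(dickson s (fun g x => count_mem x (W g))).
case=> g [h [g_dead _ gh Wgh]]; apply: gh.
have [[gW gE] [hW hE]] := (W_geo g, W_geo h).
rewrite -gE -hE; apply: (dead_end_antichain genX abG) => //; first by rewrite gE.
by move=> x; rewrite sE inE; apply: Wgh.
Qed.
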